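(* Let $n\ge 1$ be an integer, let $\mathbb{F}$ be a field of prime characteristic $p$ whose cardinality is at least $p^n$ (possibly infinite), and assume $(n,p)\neq(1,2)$, so that the Jacobson-Witt algebra $\mathfrak{g}=W_n$ over $\mathbb{F}$ is simple. Then every 2-local derivation on $\mathfrak{g}$ is a derivation of $\mathfrak{g}$.
   Context: Truncated polynomial algebra: $\mathfrak{A}_n=\mathbb{F}[x_1,\dots,x_n]/(x_1^p,\dots,x_n^p)$. The Jacobson-Witt algebra is the Lie algebra $W_n=\mathrm{Der}(\mathfrak{A}_n)$ of $\mathbb{F}$-linear derivations of the associative algebra $\mathfrak{A}_n$; it is a free $\mathfrak{A}_n$-module with basis $D_1,\dots,D_n$, where $D_i=\partial/\partial x_i$, and $[fD_i,gD_j]=fD_i(g)D_j-gD_j(f)D_i$. It is simple unless $n=1$ and $p=2$. A derivation of a Lie algebra $\mathfrak{g}$ is a linear map $D:\mathfrak{g}\to\mathfrak{g}$ with $D([x,y])=[D(x),y]+[x,D(y)]$ for all $x,y$. A map $\Delta:\mathfrak{g}\to\mathfrak{g}$ (not assumed linear) is a 2-local derivation if for any $x,y\in\mathfrak{g}$ there is a derivation $D_{xy}$ of $\mathfrak{g}$ (depending on $x,y$) such that $\Delta(x)=D_{xy}(x)$ and $\Delta(y)=D_{xy}(y)$. *)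

(* Defs.v *)
From HB Require Import structures.
From mathcomp Require Import all_boot all_algebra.
From mathcomp Require Import boolp functions mpoly.

Set Implicit Arguments.
Unset Strict Implicit.
Unset Printing Implicit Defensive.

Import GRing.Theory.

Local Open Scope ring_scope.
Local Open Scope quotient_scope.

HB.mixin Record isLieAlgebra (R : comNzRingType) V of GRing.Lmodule R V := {
  lie : V -> V -> V;
  lie_linearl : forall z, linear (fun x => lie x z);
  lie_linearr : forall z, linear (lie z);
  liexx : forall x, lie x x = 0;
  lie_jacobi : forall x y z,
    lie x (lie y z) + lie y (lie z x) + lie z (lie x y) = 0
}.

#[short(type="lieAlgType")]
HB.structure Definition LieAlgebra (R : comNzRingType) :=
  {V of GRing.Lmodule R V & isLieAlgebra R V}.

Definition lie_derivation (R : comNzRingType) (g : lieAlgType R)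
    (D : g -> g) : Prop :=
  linear D /\ forall x y : g, D (lie x y) = lie (D x) y + lie x (D y).

(* Delta is an arbitrary map: neither additive nor homogeneous a priori, and the
   derivation D may depend on both x and y. *)
Definition two_local_derivation (R : comNzRingType) (g : lieAlgType R)
    (Delta : g -> g) : Prop :=
  forall x y : g, exists D : g -> g,
    [/\ lie_derivation D, Delta x = D x & Delta y = D y].

Section Der.
Variables (R : comNzRingType) (A : algType R).

Definition derivation (D : A -> A) : Prop :=
  linear D /\ forall a b : A, D (a * b) = D a * b + a * D b.

Definition derivation_pred : {pred A -> A} := fun D => `[< derivation D >].

Lemma derivation_predP D : reflect (derivation D) (D \in derivation_pred).
Proof. exact: asboolP. Qed.

Fact derivation_pred_submod : submod_closed derivation_pred.
Proof.
split=> [|c D E /derivation_predP[Dl DM] /derivation_predP[El EM]];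
  apply/derivation_predP; split.
- by move=> c a b; rewrite scaler0 addr0.
- by move=> a b; rewrite mul0r mulr0 addr0.
- move=> d a b; rewrite !fctE Dl El !scalerDr !scalerA (mulrC c d) -!addrA.
  by congr (_ + _); rewrite addrCA.
- move=> a b; rewrite !fctE DM EM !scalerDr mulrDl mulrDr.
  by rewrite scalerAl scalerAr addrACA.
Qed.

HB.instance Definition _ :=
  GRing.isSubmodClosed.Build R (A -> A) derivation_pred derivation_pred_submod.

(* Der(A), as a Lie subalgebra of End(A); linearity is over the base ring R. *)
Record der := Der { der_val :> A -> A; _ : der_val \in derivation_pred }.

HB.instance Definition _ := [isSub for der_val].
HB.instance Definition _ := [Choice of der by <:].
HB.instance Definition _ := [SubChoice_isSubLmodule of der by <:].

Lemma derP (D : der) : derivation D.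
Proof. by apply/derivation_predP; case: D. Qed.

Fact commutator_subproof (D E : der) :
  (fun a => D (E a) - E (D a)) \in derivation_pred.
Proof.
have [[Dl DM] [El EM]] := (derP D, derP E).
have DD a b : D (a + b) = D a + D b by rewrite -[a]scale1r Dl !scale1r.
have ED a b : E (a + b) = E a + E b by rewrite -[a]scale1r El !scale1r.
apply/derivation_predP; split=> [c a b|a b].
  by rewrite El Dl Dl El opprD addrACA scalerBr.
rewrite EM DM DD ED !DM !EM mulrBl mulrBr !opprD.
set u := D (E a) * b; set v := E (D a) * b; set w := a * D (E b).
set z := a * E (D b); set s := E a * D b; set t := D a * E b.
rewrite [LHS](AC ((2*2)*(2*2)) ((1*5)*(4*8)*((3*6)*(2*7))))/=.
by rewrite !subrr !addr0.
Qed.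

Definition commutator (D E : der) : der := Der (commutator_subproof D E).

Fact der_eqP (D E : der) : (forall a, D a = E a) -> D = E.
Proof. by move=> DE; apply/val_inj/funext. Qed.

Let derD (D : der) a b : D (a + b) = D a + D b.
Proof. by have [Dl _] := derP D; rewrite -[a]scale1r Dl !scale1r. Qed.

Let derN (D : der) a : D (- a) = - D a.
Proof.
have D0 : D 0 = 0 by apply: (addrI (D 0)); rewrite -derD !addr0.
by apply: (addrI (D a)); rewrite -derD !subrr D0.
Qed.

Let derZ (D : der) c a : D (c *: a) = c *: D a.
Proof.
have D0 : D 0 = 0 by apply: (addrI (D 0)); rewrite -derD !addr0.
by have [Dl _] := derP D; rewrite -[c *: a]addr0 Dl D0 addr0.
Qed.

Fact commutator_linearl (F : der) : linear (fun D => commutator D F).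
Proof.
move=> c D E; apply: der_eqP => a /=; rewrite !fctE /= derD derZ scalerBr.
by rewrite opprD addrACA.
Qed.

Fact commutator_linearr (F : der) : linear (commutator F).
Proof.
move=> c D E; apply: der_eqP => a /=; rewrite !fctE /= derD derZ scalerBr.
by rewrite opprD addrACA.
Qed.

Fact commutatorxx (D : der) : commutator D D = 0.
Proof. by apply: der_eqP => a /=; rewrite subrr. Qed.

Fact commutator_jacobi (D E F : der) :
  commutator D (commutator E F) + commutator E (commutator F D)
    + commutator F (commutator D E) = 0.
Proof.
apply: der_eqP => a /=; rewrite !fctE /= !derD !derN !opprD !opprK.
rewrite [LHS](AC ((2*2)*(2*2)*(2*2))
  ((1*11)*(8*2)*(5*3)*(4*10)*(12*6)*(9*7)))/=.
by rewrite !subrr !addr0.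
Qed.

HB.instance Definition _ := isLieAlgebra.Build R der
  commutator_linearl commutator_linearr commutatorxx commutator_jacobi.

End Der.

Section TruncatedPolynomials.
Variables (F : fieldType) (p : nat) (charFp : p \in [pchar F]) (n : nat).

(* The ideal (x_1^p, ..., x_n^p). The proof of p \in [pchar F] is carried as a
   parameter because {ideal_quot _} requires a proper ideal, hence p > 0. *)
Definition trunc_ideal of p \in [pchar F] : {pred {mpoly F[n]}} :=
  fun f => `[< exists q : 'I_n -> {mpoly F[n]},
                 f = \sum_(i < n) q i * 'X_i ^+ p >].

Fact trunc_ideal_closed : idealr_closed (trunc_ideal charFp).
Proof.
split=> [||a u v /asboolP[q ->] /asboolP[r ->]].
- by apply/asboolP; exists (fun=> 0); rewrite big1 // => i _; rewrite mul0r.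
- apply/negP => /asboolP[q /(congr1 (meval (fun=> 0)))].
  rewrite meval1 raddf_sum big1 ?(rwP eqP) ?oner_eq0 //= => i _.
  have p_gt0 := prime_gt0 (pcharf_prime charFp).
  by rewrite mevalM rmorphXn /= mevalXU expr0n eqn0Ngt p_gt0 mulr0.
- apply/asboolP; exists (fun i => a * q i + r i).
  rewrite mulr_sumr -big_split; apply: eq_bigr => i _.
  by rewrite mulrDl mulrA.
Qed.

HB.instance Definition _ :=
  isIdealr.Build {mpoly F[n]} (trunc_ideal charFp) trunc_ideal_closed.

Definition truncpoly : Type := {ideal_quot (trunc_ideal charFp)}.

HB.instance Definition _ := GRing.ComNzRing.on truncpoly.

Definition trunc_proj (f : {mpoly F[n]}) : truncpoly :=
  \pi_{ideal_quot (trunc_ideal charFp)} f.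

Fact trunc_proj_zmod : zmod_morphism trunc_proj.
Proof. exact: pi_is_zmod_morphism. Qed.
Fact trunc_proj_monoid : monoid_morphism trunc_proj.
Proof. exact: pi_is_monoid_morphism. Qed.
HB.instance Definition _ :=
  GRing.isZmodMorphism.Build {mpoly F[n]} truncpoly trunc_proj trunc_proj_zmod.
HB.instance Definition _ :=
  GRing.isMonoidMorphism.Build {mpoly F[n]} truncpoly trunc_proj
    trunc_proj_monoid.

(* Scalars act on the quotient through the constant polynomials. *)
Definition trunc_scale (c : F) (a : truncpoly) : truncpoly :=
  trunc_proj c%:MP * a.

Fact trunc_scaleA c d a : trunc_scale c (trunc_scale d a) = trunc_scale (c * d) a.
Proof. by rewrite /trunc_scale mpolyCM rmorphM mulrA. Qed.
Fact trunc_scale1 : left_id 1 trunc_scale.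
Proof. by move=> a; rewrite /trunc_scale mpolyC1 rmorph1 mul1r. Qed.
Fact trunc_scaleDr : right_distributive trunc_scale +%R.
Proof. by move=> c a b; rewrite /trunc_scale mulrDr. Qed.
Fact trunc_scaleDl a : {morph trunc_scale^~ a : c d / c + d}.
Proof. by move=> c d; rewrite /trunc_scale mpolyCD rmorphD mulrDl. Qed.
HB.instance Definition _ := GRing.Zmodule_isLmodule.Build F truncpoly
  trunc_scaleA trunc_scale1 trunc_scaleDr trunc_scaleDl.

Fact trunc_scaleAl (c : F) (a b : truncpoly) : c *: (a * b) = (c *: a) * b.
Proof. exact: mulrA. Qed.
HB.instance Definition _ :=
  GRing.Lmodule_isLalgebra.Build F truncpoly trunc_scaleAl.

Fact trunc_scaleAr (c : F) (a b : truncpoly) : c *: (a * b) = a * (c *: b).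
Proof. by rewrite mulrC trunc_scaleAl mulrC. Qed.
HB.instance Definition _ :=
  GRing.Lalgebra_isAlgebra.Build F truncpoly trunc_scaleAr.

End TruncatedPolynomials.

Definition jacobson_witt (F : fieldType) (p : nat) (charFp : p \in [pchar F])
    (n : nat) : lieAlgType F := der (truncpoly charFp n).

(* Main.v *)
From HB Require Import structures.
Require Import Defs.
From mathcomp Require Import all_boot all_algebra.
From mathcomp Require Import boolp functions mpoly ring zify.

Set Implicit Arguments.
Unset Strict Implicit.
Unset Printing Implicit Defensive.

Import GRing.Theory.

Local Open Scope ring_scope.

(** Write A for the truncated polynomial algebra and put X_i = 1 + x_i.  Since
X_i^p = 1, the monomials X^g, for g in G = F_p^n, form a basis of A and
multiply like the elements of the group G.  With d_i = X_i D_i, the derivations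
X^g s, where s = \sum_i s_i d_i, span W = Der A, and
  [X^g s, X^h t] = X^(g+h) (h(s) t - g(t) s),    h(s) = \sum_i h_i s_i.
As F has at least p^n elements, there is a point a0 of F^n whose values g(a0),
g in G, are pairwise distinct.  The element T0 = \sum_i (a0)_i d_i is then
diagonal on A with simple spectrum, its centralizer in W is the torus T spanned
by the d_i, and its eigenspaces in W are the X^g T.  The proof has three steps.

All derivations of W are inner (derivation_inner).  Subtracting an inner
derivation makes a derivation D vanish at T0, so that D preserves each X^g T;
since the D_i commute, it also multiplies each D_i by a scalar, and an element
of T corrects this.  A derivation that kills T0 and all D_i kills every X^b D_j,
by induction on the total degree of b: the bracket of D(X^b D_j) with each D_i
is zero, so D(X^b D_j) is a combination of the D_i, and its weight then leaves
one case, which an explicit bracket settles.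

Two-local derivations are linear (two_local_derivation_linear).  Let rho be the
representation of W on A.  If Delta coincides with ad u at y and at z, then
  tr(rho(y)^k rho(Delta z))
    = - \sum_(i < k) tr(rho(y)^i rho(Delta y) rho(y)^(k-1-i) rho(z)),
and the right-hand side is linear in z although u depends on z.  Hence
w = Delta(c z + z') - c Delta z - Delta z' satisfies tr(rho(y)^k rho(w)) = 0
for all y and k, and it remains to see that such a w is zero
(der_mx_nondegenerate).  Taking y = T0, whose powers separate the p^n
eigenlines, shows that w has no component in T.  Taking y = T0 + s [u, T0] and
extracting the coefficient of s, which is possible for k < p^n as F has more
than k elements, gives the same for every [u, w].  Applied to
u = X^(-g) t this kills the component of w in X^g T; here (n, p) <> (1, 2) is
used.

A linear two-local derivation is inner (two_local_derivation_torus).  After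
subtracting an inner derivation Delta vanishes at T0, so at each point it
coincides with ad t for some t in T.  Every X^g d_i is therefore an eigenvector
of Delta, and comparing with the value of Delta at the sum of all the X^g d_i
shows that a single t serves for all of them. *)

(** * Power sums and polynomial functions *)

(** Every polynomial of degree less than #|T| annihilates the family, in
particular the one that vanishes at all values of lam but one. *)
Lemma power_sums_eq0 (F : fieldType) (V : lmodType F) (T : finType)
    (lam : T -> F) (c : T -> V) :
    injective lam ->
    (forall k, (k < #|T|)%N -> \sum_t lam t ^+ k *: c t = 0) ->
  forall t, c t = 0.
Proof.
move=> lam_inj sums0 t.
have poly_sum0 (q : {poly F}) :
    (size q <= #|T|)%N -> \sum_u q.[lam u] *: c u = 0.
  move=> leqT; under eq_bigr do rewrite horner_coef scaler_suml.
  rewrite exchange_big /= big1 // => i _; under eq_bigr do rewrite -scalerA.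
  by rewrite -scaler_sumr sums0 ?scaler0 // (leq_trans (ltn_ord i)).
pose q := \prod_(u <- enum (predC1 t)) ('X - (lam u)%:P).
have rootq x : root q x = (x \in map lam (enum (predC1 t))).
  by rewrite -root_prod_XsubC big_map.
have /poly_sum0 : (size q <= #|T|)%N.
  by rewrite size_prod_XsubC -cardE cardC1 prednK //; apply/card_gt0P; exists t.
rewrite (bigD1 t) //= big1 ?addr0 => [/eqP|u u_neq_t].
  rewrite scaler_eq0 => /orP[|/eqP//]; rewrite -[_ == 0]/(root _ _) rootq.
  by rewrite mem_map // mem_enum !inE eqxx.
rewrite (_ : q.[_] = 0) ?scale0r //; apply/eqP; rewrite -[_ == 0]/(root _ _).
by rewrite rootq mem_map // mem_enum.
Qed.

Lemma poly_function_coef_eq0 (F : fieldType) (N k : nat) (f : 'I_N -> F)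
    (c : nat -> F) :
    injective f -> (k < N)%N ->
    (forall s, \sum_(i < k.+1) c i * s ^+ i = 0) ->
  forall i, (i <= k)%N -> c i = 0.
Proof.
move=> f_inj ltkN c0 i leik.
suff P0 : \poly_(i < k.+1) c i = 0.
  by have := coef_poly k.+1 c i; rewrite P0 coef0 ltnS leik.
apply/eqP/negPn/negP => P_neq0.
have := max_poly_roots P_neq0 (rs := codom f).
rewrite map_inj_uniq ?enum_uniq // size_codom card_ord.
suff -> : all (root (\poly_(i < k.+1) c i)) (codom f).
  move=> /(_ isT isT) ltNP; have := leq_trans ltNP (size_poly _ _).
  by rewrite ltnS leqNgt ltkN.
by apply/allP => s _; rewrite /root horner_poly c0.
Qed.

(** * Powers in noncommutative rings *)

Section Words.
Variable R : pzRingType.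
Implicit Types x y u z : R.

(** The differential of the k-th power map at x, in the direction y. *)
Definition power_deriv x y k : R := \sum_(i < k) x ^+ i * y * x ^+ (k - i.+1).

Lemma power_derivS x y k :
  power_deriv x y k.+1 = y * x ^+ k + x * power_deriv x y k.
Proof.
rewrite /power_deriv big_ord_recl /= expr0 mul1r subn1 mulr_sumr.
by congr (_ + _); apply: eq_bigr => i _; rewrite exprS !mulrA subSS.
Qed.

(** Conjugation invariance of the k-th power map, in infinitesimal form; the sum
telescopes. *)
Lemma power_deriv_commutator x u k :
  power_deriv x (u * x - x * u) k = u * x ^+ k - x ^+ k * u.
Proof.
elim: k => [|k IHk]; first by rewrite /power_deriv big_ord0 mulr1 mul1r subrr.
rewrite power_derivS IHk mulrBl mulrBr exprS !mulrA.
by rewrite addrA subrK.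
Qed.

(** The powers of a line are polynomials in its central parameter.  Only the
coefficient of degree one is identified, as it is the one that carries
information on the direction of the line. *)
Lemma power_expansion x y k : exists2 C : nat -> R,
    C 1%N = power_deriv x y k
  & forall c : R, (forall z, c * z = z * c) ->
      (x + c * y) ^+ k = \sum_(i < k.+1) c ^+ i * C i.
Proof.
(* The induction needs the constant coefficient, and the vanishing of the
   coefficients beyond the degree. *)
suff [C [C0 C1 C_gt CE]] : exists C : nat -> R,
    [/\ C 0%N = x ^+ k, C 1%N = power_deriv x y k,
        forall i, (k < i)%N -> C i = 0
      & forall c : R, (forall z, c * z = z * c) ->
      (x + c * y) ^+ k = \sum_(i < k.+1) c ^+ i * C i] by exists C.
elim: k => [|k [C [C0 C1 C_gt CE]]].
  exists (fun i => if i is 0%N then 1 else 0).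
  split=> //; first by rewrite /power_deriv big_ord0.
    by case.
  by move=> c _; rewrite big_ord1 !expr0 mulr1.
exists (fun i => if i is j.+1 then x * C j.+1 + y * C j else x * C 0%N).
split=> [|||c cC].
- by rewrite C0 exprS.
- by rewrite C0 C1 power_derivS addrC.
- by case=> // i ltki; rewrite !C_gt ?mulr0 ?addr0 // ltnW.
have cX j z : z * c ^+ j = c ^+ j * z.
  by elim: j => [|j IHj]; rewrite ?mulr1 ?mul1r // exprSr mulrA IHj -!mulrA cC.
rewrite exprS CE // mulrDl !mulr_sumr [RHS]big_ord_recl /=.
under [in RHS]eq_bigr do rewrite mulrDr.
rewrite big_split /= addrA; congr (_ + _).
  rewrite big_ord_recl [X in _ = _ + X]big_ord_recr /= !add0n (C_gt k.+1) //.
  rewrite !mulr0 addr0 expr0 !mul1r; congr (_ + _); apply: eq_bigr => i _.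
  by rewrite /bump /= !add0n !add1n !mulrA cX.
apply: eq_bigr => i _; rewrite /bump /= add0n add1n exprS -!mulrA.
congr (_ * _).
by rewrite !mulrA cX.
Qed.

End Words.

(** * Weights: pairing vectors over the prime field with vectors over F *)

Lemma Zp_pred m (x : 'I_m.+2) : x != 0 -> (nat_of_ord (x - 1)%R).+1 = x :> nat.
Proof.
rewrite -{1 3}[x](subrK 1); move: (x - 1) => y y_neq.
have yE : nat_of_ord (y + 1)%R = (y.+1 %% m.+2)%N :> nat.
  by rewrite /= (modn_small (m := 1)) // addn1.
rewrite yE modn_small // ltn_neqAle ltn_ord andbT.
apply: contra y_neq => /eqP ym; apply/eqP/val_inj; apply: etrans yE _.
by rewrite ym modnn.
Qed.

Section PrimeField.
Variables (F : fieldType) (p : nat) (charFp : p \in [pchar F]).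

(** The ring embedding of the prime field; the characteristic appears as an
argument so that the morphism structure can be attached to the function. *)
Definition prime_embed of p \in [pchar F] : 'F_p -> F := fun a => (a : nat)%:R.
Local Notation iota := (prime_embed charFp).

Let p_prime : prime p := pcharf_prime charFp.
Let pE : (Zp_trunc (pdiv p)).+2 = p := Fp_cast p_prime.

Lemma natr_modFp m : (m %% (Zp_trunc (pdiv p)).+2)%:R = m%:R :> F.
Proof. by rewrite pE GRing.natr_mod_pchar. Qed.

Fact prime_embed_zmod : zmod_morphism iota.
Proof.
have iotaD a b : iota (a + b) = iota a + iota b.
  by rewrite /prime_embed /= natr_modFp natrD.
by move=> a b; apply/eqP; rewrite eq_sym subr_eq -iotaD subrK.
Qed.
Fact prime_embed_monoid : monoid_morphism iota.
Proof. by split=> // a b; rewrite /prime_embed /= natr_modFp natrM. Qed.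
HB.instance Definition _ :=
  GRing.isZmodMorphism.Build 'F_p F iota prime_embed_zmod.
HB.instance Definition _ :=
  GRing.isMonoidMorphism.Build 'F_p F iota prime_embed_monoid.

(** The weight g of the torus T, evaluated at \sum_i c_i d_i. *)
Definition weight m (g : 'rV['F_p]_m) (c : 'rV[F]_m) : F :=
  \sum_i iota (g 0 i) * c 0 i.

Lemma prime_embed_eq0 a : (iota a == 0) = (a == 0).
Proof. by rewrite fmorph_eq0. Qed.

Lemma weight0l m (c : 'rV[F]_m) : weight 0 c = 0.
Proof. by rewrite /weight big1 // => i _; rewrite mxE rmorph0 mul0r. Qed.

Lemma weight0r m (g : 'rV['F_p]_m) : weight g 0 = 0.
Proof. by rewrite /weight big1 // => i _; rewrite mxE mulr0. Qed.

Lemma weightDl m (g g' : 'rV['F_p]_m) c :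
  weight (g + g') c = weight g c + weight g' c.
Proof.
rewrite /weight -big_split; apply: eq_bigr => i _.
by rewrite mxE rmorphD mulrDl.
Qed.

Lemma weightBl m (g g' : 'rV['F_p]_m) c :
  weight (g - g') c = weight g c - weight g' c.
Proof. by apply/eqP; rewrite eq_sym subr_eq -weightDl subrK. Qed.

Lemma weightNl m (g : 'rV['F_p]_m) c : weight (- g) c = - weight g c.
Proof. by rewrite -[- g]add0r weightBl weight0l add0r. Qed.

Lemma weight_is_linear m (g : 'rV['F_p]_m) : scalar (weight g).
Proof.
move=> k c d; rewrite /weight mulr_sumr -big_split; apply: eq_bigr => i _.
by rewrite !mxE mulrDr mulrCA.
Qed.
HB.instance Definition _ m g :=
  GRing.isLinear.Build F 'rV[F]_m F _ (weight g) (@weight_is_linear m g).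

Lemma weight_delta m (g : 'rV['F_p]_m) i :
  weight g (delta_mx 0 i) = iota (g 0 i).
Proof.
rewrite /weight (bigD1 i) //= mxE !eqxx mulr1 big1 ?addr0 // => j ji.
by rewrite mxE (negPf ji) andbF mulr0.
Qed.

Lemma weight_deltal m (c : 'rV[F]_m) i : weight (delta_mx 0 i) c = c 0 i.
Proof.
rewrite /weight (bigD1 i) //= mxE !eqxx rmorph1 mul1r big1 ?addr0 // => j ji.
by rewrite mxE (negPf ji) andbF rmorph0 mul0r.
Qed.

(** The coordinates of the point are chosen one at a time, linearly independent
over the prime field: m of them span only p ^ m < p ^ n elements of F, so one of
the p ^ n given elements lies outside their span. *)
Lemma exists_injective_weight n (f : 'I_(p ^ n) -> F) : injective f ->
  exists a : 'rV[F]_n, injective (fun g : 'rV['F_p]_n => weight g a).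
Proof.
move=> f_inj; pose form (a : nat -> F) m (g : 'rV['F_p]_m) : F :=
  \sum_(i < m) iota (g 0 i) * a i.
suff indep m : (m <= n)%N ->
    exists a : nat -> F, forall g : 'rV['F_p]_m, form a m g = 0 -> g = 0.
  have [a a_ker] := indep n (leqnn n); exists (\row_i a i) => g g' eqg.
  apply/eqP; rewrite -subr_eq0; apply/eqP/a_ker.
  transitivity (weight (g - g') (\row_i a i)); last first.
    by rewrite weightBl eqg subrr.
  by apply: eq_bigr => i _; rewrite mxE.
elim: m => [_|m IHm ltmn].
  by exists (fun=> 0) => g _; apply/rowP; case.
have [a a_ker] := IHm (ltnW ltmn).
have [z zP] : exists z, z \notin codom (form a m).
  have [/allP all_im|/allPn[z _ zP]] :=
    boolP (all (mem (codom (form a m))) (codom f)); last by exists z.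
  have : (size (codom f) <= size (codom (form a m)))%N.
    by apply: uniq_leq_size => //; rewrite map_inj_uniq ?enum_uniq.
  rewrite !size_codom card_ord card_mx mul1n card_Fp // leqNgt ltn_exp2l //.
    by rewrite ltmn.
  exact: prime_gt1.
exists (fun i => if (i < m)%N then a i else z) => g.
rewrite /form big_ord_recr /= ltnn.
under eq_bigr do rewrite ltn_ord.
have [gm0|gm_neq0] := eqVneq (g 0 ord_max) 0.
  rewrite gm0 rmorph0 mul0r addr0 => g0.
  have /rowP g'0 : \row_(i < m) g 0 (widen_ord (leqnSn m) i) = 0.
    by apply: a_ker; rewrite -[RHS]g0; apply: eq_bigr => i _; rewrite mxE.
  apply/rowP => i; rewrite mxE; have [ltim|leim] := ltnP i m.
    have := g'0 (Ordinal ltim); rewrite !mxE => <-.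
    by congr (g _ _); apply: val_inj.
  rewrite -[RHS]gm0; congr (g _ _); apply: val_inj; apply/eqP.
  by rewrite eqn_leq leim -ltnS ltn_ord.
move=> /eqP; rewrite addrC addr_eq0 => /eqP gz; case/negP: zP.
apply/codomP; exists (\row_(i < m) (- (g 0 (widen_ord (leqnSn m) i)
                                        / g 0 ord_max))).
have im_neq0 : iota (g 0 ord_max) != 0 by rewrite prime_embed_eq0.
apply: (mulfI im_neq0); rewrite gz /form mulr_sumr -sumrN.
apply: eq_bigr => i _; rewrite mxE rmorphN fmorph_div mulrA mulrN mulNr.
by rewrite mulrCA divff // mulr1.
Qed.

End PrimeField.

(** * Linear maps, Lie algebras and their derivations *)

(** Linearity as a property of a bare function, which is the form in which it
occurs in the definition of a derivation. *)
Section LinearMaps.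
Variables (R : comNzRingType) (U V : lmodType R) (f : U -> V).
Hypothesis f_lin : linear f.

Lemma linear_addE x y : f (x + y) = f x + f y.
Proof. by rewrite -[x]scale1r f_lin !scale1r. Qed.

Lemma linear_0E : f 0 = 0.
Proof. by apply: (addrI (f 0)); rewrite -linear_addE !addr0. Qed.

Lemma linear_scaleE c x : f (c *: x) = c *: f x.
Proof. by rewrite -[c *: x]addr0 f_lin linear_0E addr0. Qed.

Lemma linear_oppE x : f (- x) = - f x.
Proof. by rewrite -scaleN1r linear_scaleE scaleN1r. Qed.

Lemma linear_subE x y : f (x - y) = f x - f y.
Proof. by rewrite linear_addE linear_oppE. Qed.

Lemma linear_sumE (I : Type) (r : seq I) (P : pred I) (E : I -> U) :
  f (\sum_(i <- r | P i) E i) = \sum_(i <- r | P i) f (E i).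
Proof. exact: (big_morph f linear_addE linear_0E). Qed.

End LinearMaps.

Section LieAlgebras.
Variables (R : comNzRingType) (g : lieAlgType R).
Implicit Types (x y z u : g) (D E : g -> g).

Lemma lieC x y : lie x y = - lie y x.
Proof.
apply/eqP; rewrite -addr_eq0; apply/eqP.
have := liexx (x + y); rewrite (linear_addE (lie_linearl _)).
by rewrite !(linear_addE (lie_linearr _)) !liexx add0r addr0.
Qed.

Lemma lie_derivation_inner u : lie_derivation (lie u).
Proof.
split; first exact: lie_linearr.
move=> x y; rewrite [lie (lie u x) y]lieC.
have /eqP := lie_jacobi u x y; rewrite -addrA addr_eq0 => /eqP ->.
rewrite opprD addrC; congr (_ + _).
by rewrite [lie y u]lieC (linear_oppE (lie_linearr _)) opprK.
Qed.

Lemma lie_derivation_sub D E :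
  lie_derivation D -> lie_derivation E -> lie_derivation (fun x => D x - E x).
Proof.
move=> [Dl DM] [El EM]; split=> [c x y|x y].
  by rewrite Dl El scalerBr opprD addrACA.
rewrite DM EM (linear_subE (lie_linearl _)) (linear_subE (lie_linearr _)).
by rewrite opprD addrACA.
Qed.

Lemma lie_derivation_add D E :
  lie_derivation D -> lie_derivation E -> lie_derivation (fun x => D x + E x).
Proof.
move=> [Dl DM] [El EM]; split=> [c x y|x y].
  by rewrite Dl El scalerDr addrACA.
rewrite DM EM (linear_addE (lie_linearl _)) (linear_addE (lie_linearr _)).
by rewrite addrACA.
Qed.

Lemma two_local_derivation_sub D E :
  two_local_derivation D -> lie_derivation E ->
  two_local_derivation (fun x => D x - E x).
Proof.
move=> D2 Eder x y; have [D' [D'der -> ->]] := D2 x y.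
by exists (fun x => D' x - E x); split=> //; apply: lie_derivation_sub.
Qed.

End LieAlgebras.

(** * Traces of powers and two-local derivations *)

Lemma mxtrace_mulrC (F : fieldType) N (a b : 'M[F]_N) :
  \tr (a * b) = \tr (b * a).
Proof. exact: mxtrace_mulC. Qed.

Lemma mulr_scalemx (F : fieldType) N (c : F) (a b : 'M[F]_N) :
  a * (c *: b) = c *: (a * b).
Proof. by rewrite -[LHS]scalemxAr. Qed.

Section TraceForms.
Variables (F : fieldType) (g : lieAlgType F) (N : nat) (rho : g -> 'M[F]_N).
Hypothesis rho_lin : linear rho.
Hypothesis rho_lie : forall x y, rho (lie x y) = rho x * rho y - rho y * rho x.

(** Invariance of the trace: the differential of tr(x^k w) along ad u is zero.
The right-hand side depends on u only through [u, x]. *)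
Lemma trace_power_lie (x u w : g) k :
  \tr (rho x ^+ k * rho (lie u w))
    = - \tr (power_deriv (rho x) (rho (lie u x)) k * rho w).
Proof.
rewrite !rho_lie power_deriv_commutator mulrBr mulrBl.
rewrite !raddfB /= opprK addrC !mulrA; congr (- _ + _).
by rewrite mxtrace_mulrC mulrA.
Qed.

Hypothesis inner : forall D : g -> g, lie_derivation D ->
  exists u, forall x, D x = lie u x.
Hypothesis nondeg : forall w,
  (forall x k, \tr (rho x ^+ k * rho w) = 0) -> w = 0.

(** By trace_power_lie, the numbers tr(x^k Delta w) are determined by Delta x
and depend linearly on w, whichever derivation represents Delta at x and w. *)
Lemma two_local_derivation_linear (Delta : g -> g) :
  two_local_derivation Delta -> linear Delta.
Proof.
move=> Delta2 c y z; apply/eqP; rewrite -subr_eq0; apply/eqP/nondeg => x k.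
have E w : \tr (rho x ^+ k * rho (Delta w))
    = - \tr (power_deriv (rho x) (rho (Delta x)) k * rho w).
  have [D [/inner[u Du] -> ->]] := Delta2 x w.
  by rewrite !Du trace_power_lie.
rewrite (linear_subE rho_lin) rho_lin mulrBr mulrDr !raddfD raddfN /= E rho_lin.
rewrite mulr_scalemx mxtraceZ !E.
rewrite mulrDr raddfD /= mulr_scalemx mxtraceZ.
by rewrite raddfN /= E mulrN !opprK addrC subrr.
Qed.

(** The radical of the trace forms is an ideal, as far as powers k < N are
concerned: tr((x + s [u, x])^k w) is a polynomial function of s of degree at
most k, and its coefficient of degree one is, up to sign, tr(x^k [u, w]). *)
Lemma trace_power_lie_eq0 (f : 'I_N -> F) (w : g) :
    injective f ->
    (forall x k, \tr (rho x ^+ k * rho w) = 0) ->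
  forall x u k, (k < N)%N -> \tr (rho x ^+ k * rho (lie u w)) = 0.
Proof.
move=> f_inj w0 x u k ltkN; rewrite trace_power_lie.
have [C C1 CE] := power_expansion (rho x) (rho (lie u x)) k.
case: k ltkN C1 CE => [|k] ltkN C1 CE.
  by rewrite /power_deriv big_ord0 mul0r mxtrace0 oppr0.
suff /(_ 1%N) : forall i, (i <= k.+1)%N -> \tr (C i * rho w) = 0.
  by rewrite C1 => ->; rewrite ?oppr0.
apply: poly_function_coef_eq0 f_inj ltkN _ => s.
rewrite -[RHS](w0 (x + s *: lie u x) k.+1).
rewrite addrC rho_lin addrC (_ : s *: _ = s%:M * rho (lie u x)); last first.
  by rewrite -mulmxE mul_scalar_mx.
rewrite CE => [|z]; last by rewrite -!mulmxE scalar_mxC.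
rewrite mulr_suml raddf_sum; apply: eq_bigr => i _ /=.
rewrite -rmorphXn -mulrA.
by rewrite [X in _ = \tr X]mul_scalar_mx mxtraceZ mulrC.
Qed.

End TraceForms.

(** * The group algebra structure of truncated polynomials *)

Section TruncatedAlgebra.
Variables (F : fieldType) (p : nat) (charFp : p \in [pchar F]) (n : nat).
Local Notation A := (truncpoly charFp n).
Local Notation proj := (@trunc_proj F p charFp n).
Local Notation G := 'rV['F_p]_n.
Implicit Types (g h : G) (a b : A).

Let p_prime : prime p := pcharf_prime charFp.

Lemma trunc_proj_surj a : exists f, a = proj f.
Proof. by exists (repr a); rewrite /trunc_proj reprK. Qed.

Lemma trunc_proj_eq f f' :
  reflect (proj f = proj f') (f - f' \in trunc_ideal charFp).
Proof. by rewrite Quotient.idealrBE; apply: eqP. Qed.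

Lemma trunc_projZ k f : proj (k *: f) = k *: proj f.
Proof. by rewrite -mul_mpolyC rmorphM. Qed.

Lemma trunc_proj_var_exp i : proj 'X_i ^+ p = 0.
Proof.
rewrite -rmorphXn -(rmorph0 proj); apply/trunc_proj_eq; rewrite subr0.
apply/asboolP; exists (fun j => (j == i)%:R).
by rewrite (bigD1 i) //= eqxx mul1r big1 ?addr0 // => j /negPf->; rewrite mul0r.
Qed.

(** Unlike x_i, these generators are invertible, so that the exponents of their
monomials form a group. *)
Definition unipotent i : A := 1 + proj 'X_i.

Lemma unipotent_exp i : unipotent i ^+ p = 1.
Proof.
rewrite /unipotent exprDn_pchar ?expr1n ?trunc_proj_var_exp ?addr0 //.
by rewrite (eq_pnat _ (@pchar_lalg F A)) pnatE.
Qed.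

Definition unimonomial g : A := \prod_i unipotent i ^+ (g 0 i : nat).
Local Notation mono := unimonomial.

Lemma unimonomial0 : mono 0 = 1.
Proof. by rewrite /mono big1 // => i _; rewrite mxE expr0. Qed.

Lemma unimonomialD g h : mono (g + h) = mono g * mono h.
Proof.
rewrite /mono -big_split; apply: eq_bigr => i _ /=; rewrite mxE -exprD /=.
by rewrite [X in (_ %% X)%N](Fp_cast p_prime) (expr_mod _ (unipotent_exp i)).
Qed.

Lemma unimonomial_delta i : mono (delta_mx 0 i) = unipotent i.
Proof.
rewrite /mono (bigD1 i) //= mxE !eqxx big1 => [|j ji].
  by rewrite mulr1 /= modn_small ?expr1 // (Fp_cast p_prime) prime_gt1.
by rewrite mxE (negPf ji) andbF expr0.
Qed.

Lemma unimonomialK g : mono (- g) * mono g = 1.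
Proof. by rewrite -unimonomialD addNr unimonomial0. Qed.

Definition unispan a := exists c : G -> F, a = \sum_g c g *: mono g.

Lemma unispan_mono g : unispan (mono g).
Proof.
exists (fun h => (h == g)%:R).
rewrite (bigD1 g) //= eqxx scale1r big1 ?addr0 //.
by move=> h /negPf->; rewrite scale0r.
Qed.

Lemma unispan_lin k a b : unispan a -> unispan b -> unispan (k *: a + b).
Proof.
move=> [u ->] [v ->]; exists (fun g => k * u g + v g).
rewrite scaler_sumr -big_split; apply: eq_bigr => g _.
by rewrite scalerDl scalerA.
Qed.

(** The span of the unimonomials is stable under multiplication by
x_i = X_i - 1, hence by every polynomial in the x_i. *)
Lemma unispan_full a : unispan a.
Proof.
have span0 : unispan 0.
  by exists (fun=> 0); rewrite big1 // => g _; rewrite scale0r.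
have spanM g b : unispan b -> unispan (mono g * b).
  move=> [c ->]; rewrite mulr_sumr; elim/big_ind: _ => // [x y|h _].
    by rewrite -[x in x + y]scale1r; apply: unispan_lin.
  rewrite -scalerAr -unimonomialD -[_ *: _]addr0.
  by apply: unispan_lin => //; apply: unispan_mono.
pose Q f := forall b, unispan b -> unispan (proj f * b).
have QM f f' : Q f -> Q f' -> Q (f * f').
  by move=> Qf Qf' b /Qf' /Qf; rewrite rmorphM mulrA.
have Q1 : Q 1 by move=> b; rewrite rmorph1 mul1r.
have QX i : Q 'X_i.
  move=> b b_span; rewrite (_ : proj 'X_i = unipotent i - 1).
    rewrite mulrBl mul1r addrC -scaleN1r; apply: unispan_lin => //.
    by rewrite -unimonomial_delta; apply: spanM.
  by rewrite /unipotent [1 + _]addrC addrK.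
have QXm m : Q 'X_[m].
  rewrite mpolyXE_id; elim/big_ind: _ => // i _.
  by elim: (m i) => // k IHk; rewrite exprS; apply: QM.
have [f ->] := trunc_proj_surj a; elim/mpolyind: f => [|k m f _ _ IHf].
  by rewrite rmorph0.
rewrite rmorphD /= trunc_projZ; apply: unispan_lin => //.
rewrite -[proj _]mulr1.
by apply: QXm; rewrite -unimonomial0; apply: unispan_mono.
Qed.

Definition pderiv i a : A := proj (mderiv i (repr a)).

(** The partial derivatives of x_j^p vanish in characteristic p, so the ideal of
the x_j^p is stable under them. *)
Lemma pderivE i f : pderiv i (proj f) = proj (mderiv i f).
Proof.
apply/trunc_proj_eq; rewrite -mderivB.
have /trunc_proj_eq/asboolP[q ->] : proj (repr (proj f)) = proj f.
  by rewrite /trunc_proj reprK.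
rewrite raddf_sum; apply/asboolP; exists (fun j => mderiv i (q j)).
apply: eq_bigr => j _ /=; rewrite mderivM mpolyXn mderivX mulmnE natrM.
by rewrite (pcharf0 charFp) mulr0 scale0r mulr0 addr0.
Qed.

Lemma pderiv_linear i : linear (pderiv i).
Proof.
move=> k a b; have [[f ->] [f' ->]] := (trunc_proj_surj a, trunc_proj_surj b).
by rewrite -trunc_projZ -rmorphD !pderivE linearP rmorphD /= trunc_projZ.
Qed.

Lemma pderivM i a b : pderiv i (a * b) = pderiv i a * b + a * pderiv i b.
Proof.
have [[f ->] [f' ->]] := (trunc_proj_surj a, trunc_proj_surj b).
by rewrite -rmorphM !pderivE mderivM rmorphD !rmorphM.
Qed.

Lemma derivation_exp (D : A -> A) a k :
  derivation D -> D (a ^+ k) = k%:R *: (a ^+ k.-1 * D a).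
Proof.
move=> [Dlin DM]; have D1 : D 1 = 0.
  have /eqP := DM 1 1; rewrite !mulr1 mul1r -subr_eq0 opprD addNKr oppr_eq0.
  by move/eqP.
elim: k => [|[|k] IHk]; first by rewrite expr0 D1 scale0r.
  by rewrite expr1 scale1r mul1r.
rewrite exprS DM IHk /= -scalerAr !mulrA -exprS [D a * _]mulrC.
by rewrite -[X in X + _]scale1r -scalerDl -[1]/(1%:R) -natrD.
Qed.

Lemma pderiv_unipotent i j : pderiv i (unipotent j) = (i == j)%:R.
Proof.
rewrite /unipotent -(rmorph1 proj) -rmorphD pderivE mderivD mderivX.
rewrite -mpolyC1 mderivC add0r mnmE eq_sym.
have [->|ij] := eqVneq; last by rewrite scale0r rmorph0.
by rewrite scale1r -{1}[U_(j)%MM]add0m addmK mpolyX0 mpolyC1.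
Qed.

Lemma pderiv_mono i g :
  unipotent i * pderiv i (mono g) = prime_embed charFp (g 0 i) *: mono g.
Proof.
have dD : derivation (pderiv i) by split; [apply: pderiv_linear|apply: pderivM].
have dX j m : unipotent i * pderiv i (unipotent j ^+ m)
    = ((i == j) * m)%:R *: unipotent j ^+ m.
  rewrite derivation_exp // pderiv_unipotent; have [->|_] := eqVneq.
    by case: m => [|m]; rewrite ?scale0r ?mulr0 // mulr1 -scalerAr mul1n exprS.
  by rewrite mulr0 !scaler0 mulr0 mul0n scale0r.
rewrite (_ : prime_embed _ _ = \sum_j ((i == j) * g 0 j)%:R); last first.
  rewrite (bigD1 i) //= eqxx mul1n big1 ?addr0 // => j.
  by rewrite eq_sym => /negPf->.
rewrite /mono; elim/big_ind2: _ => [|x k y l Ex Ey|j _].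
- by rewrite -[1](expr0 (unipotent i)) dX muln0.
- by rewrite pderivM mulrDr mulrA Ex mulrCA Ey -scalerAl -scalerAr -scalerDl.
- exact: dX.
Qed.

End TruncatedAlgebra.

(** * The basis of the Jacobson-Witt algebra *)

Section VectorFields.
Variables (F : fieldType) (p : nat) (charFp : p \in [pchar F]) (n : nat).
Local Notation A := (truncpoly charFp n).
Local Notation G := 'rV['F_p]_n.
Local Notation weight := (weight charFp).
Local Notation mono := (unimonomial charFp).
Implicit Types (g h : G) (a b : A) (c d : 'rV[F]_n) (w v : der A).

(** The operator X^g \sum_i c_i d_i. *)
Definition vfield_fun g c a : A :=
  mono g * \sum_i c 0 i *: (unipotent charFp i * pderiv i a).

Fact vfield_subproof g c : vfield_fun g c \in @derivation_pred F A.
Proof.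
apply/derivation_predP; split=> [k a b|a b]; rewrite /vfield_fun.
  rewrite scalerAr -mulrDr; congr (_ * _).
  rewrite scaler_sumr -big_split; apply: eq_bigr => i _ /=.
  by rewrite pderiv_linear mulrDr scalerDr -scalerAr !scalerA [_ * k]mulrC.
rewrite -[X in X + _]mulrA [a * (_ * _)]mulrCA -mulrDr; congr (_ * _).
rewrite mulr_suml mulr_sumr -big_split; apply: eq_bigr => i _ /=.
by rewrite pderivM mulrDr scalerDr mulrA mulrCA -scalerAl -scalerAr.
Qed.

Definition vfield g c : der A := Der (vfield_subproof g c).

Lemma vfieldE g c h : vfield g c (mono h) = weight h c *: mono (g + h).
Proof.
rewrite /= /vfield_fun /weight unimonomialD scalerAr; congr (_ * _).
rewrite scaler_suml; apply: eq_bigr => i _.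
by rewrite pderiv_mono scalerA mulrC.
Qed.

Lemma der_linear w : linear w.
Proof. by have [] := derP w. Qed.

Lemma der_mul w a b : w (a * b) = w a * b + a * w b.
Proof. by have [_ ->] := derP w. Qed.

Lemma der_addE w v a : (w + v) a = w a + v a. Proof. by []. Qed.
Lemma der_scaleE k w a : (k *: w) a = k *: w a. Proof. by []. Qed.
Lemma der_lieE w v a : lie w v a = w (v a) - v (w a). Proof. by []. Qed.
Lemma der_sumE (I : Type) (r : seq I) (P : pred I) (E : I -> der A) a :
  (\sum_(i <- r | P i) E i) a = \sum_(i <- r | P i) E i a.
Proof.
by elim/big_rec2: _ => // i x y _ <-.
Qed.

Lemma linear_mono_ext (f f' : A -> A) : linear f -> linear f' ->
  (forall g, f (mono g) = f' (mono g)) -> f =1 f'.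
Proof.
move=> flin f'lin ff' a; have [c ->] := unispan_full a.
rewrite (linear_sumE flin) (linear_sumE f'lin); apply: eq_bigr => g _.
by rewrite (linear_scaleE flin) (linear_scaleE f'lin) ff'.
Qed.

Lemma der_mono_ext w v : (forall g, w (mono g) = v (mono g)) -> w = v.
Proof.
by move=> wv; apply: der_eqP; apply: linear_mono_ext => //; apply: der_linear.
Qed.

Lemma vfield_linear g : linear (vfield g).
Proof.
move=> k c d; apply: der_mono_ext => h.
by rewrite der_addE der_scaleE !vfieldE linearP scalerDl scalerA.
Qed.

Lemma lie_vfield g c h d :
  lie (vfield g c) (vfield h d)
    = vfield (g + h) (weight h c *: d - weight g d *: c).
Proof.
apply: der_mono_ext => u.
rewrite der_lieE !vfieldE (linear_scaleE (der_linear _)) vfieldE.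
rewrite (linear_scaleE (der_linear _)) vfieldE !scalerA.
rewrite !addrA [h + g]addrC -scalerBl; congr (_ *: _).
by rewrite linearB !linearZ /= !weightDl; ring.
Qed.

Variable a0 : 'rV[F]_n.
Hypothesis a0_inj : injective (fun g : G => weight g a0).

(** The X^g are nonzero eigenvectors of the operator \sum_i (a0)_i d_i, for
pairwise distinct eigenvalues. *)
Lemma unimonomial_indep (c : G -> F) :
  \sum_g c g *: mono g = 0 -> forall g, c g = 0.
Proof.
move=> c0 g; have : c g *: mono g = 0.
  apply: (power_sums_eq0 (c := fun h => c h *: mono h) a0_inj) => k _.
  elim: k => [|k IHk].
    by rewrite -[RHS]c0; apply: eq_bigr => h _; rewrite scale1r.
  rewrite -[RHS](linear_0E (der_linear (vfield 0 a0))) -[in RHS]IHk.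
  rewrite (linear_sumE (der_linear _)); apply: eq_bigr => h _.
  rewrite !(linear_scaleE (der_linear _)) vfieldE add0r exprSr -!scalerA.
  by congr (_ *: _); rewrite !scalerA mulrC.
move=> /(congr1 (fun x => mono (- g) * x)).
rewrite mulr0 -scalerAr unimonomialK.
by move/eqP; rewrite scaler_eq0 oner_eq0 orbF => /eqP.
Qed.

Definition unicoord a : G -> F := projT1 (cid (unispan_full a)).

Lemma unicoordE a : a = \sum_g unicoord a g *: mono g.
Proof. exact: projT2 (cid (unispan_full a)). Qed.

Lemma unicoord_uniq (c : G -> F) g : unicoord (\sum_h c h *: mono h) g = c g.
Proof.
apply/eqP; rewrite -subr_eq0; apply/eqP.
apply: (@unimonomial_indep (fun h => unicoord (\sum_h c h *: mono h) h - c h)).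
under eq_bigr do rewrite scalerBl.
by rewrite sumrB -unicoordE subrr.
Qed.

Lemma unicoord_linear g : scalar (unicoord^~ g).
Proof.
move=> k a b; rewrite {1}[a]unicoordE {1}[b]unicoordE scaler_sumr -big_split /=.
under eq_bigr do rewrite scalerA -scalerDl.
by rewrite unicoord_uniq.
Qed.

Lemma unicoordB a b g : unicoord (a - b) g = unicoord a g - unicoord b g.
Proof. exact: (linear_subE (V := F^o) (unicoord_linear g)). Qed.

Lemma unicoordZ k a g : unicoord (k *: a) g = k * unicoord a g.
Proof. exact: (linear_scaleE (V := F^o) (unicoord_linear g)). Qed.

Lemma unicoord_sum (I : Type) (r : seq I) (P : pred I) (E : I -> A) g :
  unicoord (\sum_(i <- r | P i) E i) g = \sum_(i <- r | P i) unicoord (E i) g.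
Proof. exact: (linear_sumE (V := F^o) (unicoord_linear g)). Qed.

Lemma unicoord_mono g h : unicoord (mono g) h = (h == g)%:R.
Proof.
rewrite -[RHS](unicoord_uniq (fun u => (u == g)%:R)); congr (unicoord _ _).
rewrite (bigD1 g) //= eqxx scale1r big1 ?addr0 // => u /negPf->.
by rewrite scale0r.
Qed.


(** Multiplying by X^(-h) turns the Leibniz rule into additivity in h, so that a
derivation is determined by n values, one for each basis vector of G. *)
Definition log_deriv w h : A := mono (- h) * w (mono h).

Lemma der_mono w h : w (mono h) = mono h * log_deriv w h.
Proof. by rewrite /log_deriv mulrA [mono h * _]mulrC unimonomialK mul1r. Qed.

Lemma log_derivD w g h : log_deriv w (g + h) = log_deriv w g + log_deriv w h.
Proof.
rewrite /log_deriv opprD !unimonomialD der_mul mulrDr; congr (_ + _).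
  by rewrite mulrACA [mono (- h) * _]unimonomialK mulr1.
by rewrite mulrACA unimonomialK mul1r.
Qed.

Lemma log_derivE w h :
  log_deriv w h
    = \sum_i prime_embed charFp (h 0 i) *: log_deriv w (delta_mx 0 i).
Proof.
have log0 : log_deriv w 0 = 0.
  by apply: (addrI (log_deriv w 0)); rewrite -log_derivD !addr0.
have logMn g k : log_deriv w (g *+ k) = k%:R *: log_deriv w g.
  elim: k => [|k IHk]; first by rewrite scale0r log0.
  by rewrite mulrS log_derivD IHk -natr1 scalerDl scale1r addrC.
rewrite {1}(row_sum_delta h) (big_morph _ (log_derivD w) log0).
apply: eq_bigr => i _; rewrite -logMn; congr log_deriv.
by rewrite -scaler_nat natr_Zp.
Qed.

(** The vector c such that X^g \sum_i c_i d_i is the summand of w in X^g T; its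
i-th entry is the coefficient of X^g in X_i^-1 w(X_i). *)
Definition component w g : 'rV[F]_n :=
  \row_i unicoord (log_deriv w (delta_mx 0 i)) g.

Lemma weight_component w g h :
  weight h (component w g) = unicoord (log_deriv w h) g.
Proof.
rewrite log_derivE unicoord_sum; apply: eq_bigr => i _.
by rewrite unicoordZ mxE.
Qed.

Lemma unicoord_der w g h :
  unicoord (w (mono h)) (g + h) = weight h (component w g).
Proof.
rewrite weight_component der_mono [log_deriv w h]unicoordE mulr_sumr.
rewrite !unicoord_sum; apply: eq_bigr => u _.
rewrite -scalerAr -unimonomialD !unicoordZ !unicoord_mono [h + u]addrC.
by rewrite (inj_eq (addIr h)).
Qed.

Lemma der_decomposition w : w = \sum_g vfield g (component w g).
Proof.
apply: der_mono_ext => h; rewrite der_sumE.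
under eq_bigr do rewrite vfieldE unimonomialD weight_component mulrC scalerAr.
by rewrite -mulr_sumr -unicoordE der_mono.
Qed.

Lemma component_linear g : linear (component^~ g).
Proof.
move=> k w v; apply/rowP => i; rewrite !mxE -unicoord_linear.
congr (unicoord _ g).
by rewrite /log_deriv der_addE der_scaleE mulrDr scalerAr.
Qed.

Lemma component_vfield g c h : component (vfield g c) h = (h == g)%:R *: c.
Proof.
apply/rowP => i; rewrite !mxE /log_deriv vfieldE unimonomialD -scalerAr.
rewrite mulrCA unimonomialK mulr1 unicoordZ unicoord_mono weight_deltal.
by rewrite mulrC.
Qed.

Lemma component_ext w v : (forall g, component w g = component v g) -> w = v.
Proof.
move=> wv; rewrite (der_decomposition w) (der_decomposition v).
by apply: eq_bigr => g _; rewrite wv.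
Qed.

Lemma component_lie_vfield g c w h :
  component (lie (vfield g c) w) h
    = weight (h - g) c *: component w (h - g)
      - weight g (component w (h - g)) *: c.
Proof.
rewrite {1}(der_decomposition w) (linear_sumE (lie_linearr _)).
rewrite (linear_sumE (component_linear h)) (bigD1 (h - g)) //= lie_vfield.
rewrite component_vfield [g + _]addrC subrK eqxx scale1r.
rewrite big1 ?addr0 // => u u_neq.
rewrite lie_vfield component_vfield [g + u]addrC -subr_eq eq_sym.
by rewrite (negPf u_neq) scale0r.
Qed.

Definition der_mx w : 'M[F]_#|{: G}| :=
  \matrix_(i, j) unicoord (w (mono (enum_val j))) (enum_val i).

Lemma der_mx_linear : linear der_mx.
Proof.
move=> k w v; apply/matrixP => i j.
by rewrite !mxE der_addE der_scaleE unicoord_linear.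
Qed.

Lemma der_mx_lie w v :
  der_mx (lie w v) = der_mx w * der_mx v - der_mx v * der_mx w.
Proof.
have comp_mx (f f' : der A) i j :
    unicoord (f (f' (mono (enum_val j)))) (enum_val i)
      = (der_mx f * der_mx f') i j.
  rewrite mxE {1}[f' _]unicoordE (linear_sumE (der_linear _)) unicoord_sum.
  rewrite (reindex_onto (@enum_val G G) enum_rank) /= => [|g _]; last first.
    exact: enum_rankK.
  apply: eq_big => [k|k _]; first by rewrite enum_valK eqxx.
  by rewrite (linear_scaleE (der_linear _)) unicoordZ !mxE mulrC.
by apply/matrixP => i j; rewrite [LHS]mxE der_lieE unicoordB !comp_mx !mxE.
Qed.

(** The operator \sum_i (a0)_i d_i is diagonal in the basis of the unimonomials,
and only the summand of w in T contributes to its diagonal. *)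
Lemma trace_der_mx_torus k w :
  \tr (der_mx (vfield 0 a0) ^+ k * der_mx w)
    = \sum_g weight g a0 ^+ k * weight g (component w 0).
Proof.
pose lam : 'rV[F]_#|{: G}| := \row_i weight (enum_val i) a0.
have -> : der_mx (vfield 0 a0) = diag_mx lam.
  apply/matrixP => i j; rewrite !mxE vfieldE add0r unicoordZ unicoord_mono.
  rewrite (inj_eq enum_val_inj); have [->|_] := eqVneq; last by rewrite mulr0.
  by rewrite mulr1.
have -> : diag_mx lam ^+ k = diag_mx (\row_i (lam 0 i ^+ k)).
  elim: k => [|k IHk].
    by rewrite expr0; apply/matrixP => i j; rewrite !mxE expr0.
  rewrite exprS IHk -[LHS]/(_ *m _) mulmx_diag; congr diag_mx.
  by apply/rowP => i; rewrite !mxE exprS.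
rewrite -[_ * _]/(_ *m _) mul_diag_mx /mxtrace.
rewrite [RHS](reindex_onto (@enum_val G G) enum_rank) /= => [|g _]; last first.
  exact: enum_rankK.
apply: eq_big => [i|i _]; first by rewrite enum_valK eqxx.
by rewrite !mxE -[X in unicoord _ X]add0r unicoord_der.
Qed.

End VectorFields.

(** * Nondegeneracy of the trace forms *)

Section WittAlgebra.
Variables (F : fieldType) (p : nat) (charFp : p \in [pchar F]) (n : nat).
Local Notation A := (truncpoly charFp n).
Local Notation G := 'rV['F_p]_n.
Local Notation weight := (weight charFp).
Local Notation vf := (vfield charFp).
Local Notation "''e_' i" := (delta_mx 0 i) (at level 8, i at level 2).
Implicit Types (g h : G) (c d : 'rV[F]_n) (w v : der A).

Let p_prime : prime p := pcharf_prime charFp.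

(** The vector on the left is the bracket of X^g c with X^(-g) s, up to sign; in
the simple algebra W no nonzero X^g c with g <> 0 can commute with all of these.
Taking s along a coordinate where g is nonzero leaves only one entry of c, which
is killed by 2 when p is odd, and by the choice of another coordinate when
p = 2. *)
Lemma weight_sym_eq0 g c :
    ~ (n = 1%N /\ p = 2%N) -> g != 0 ->
    (forall s, weight g s *: c + weight g c *: s = 0) ->
  c = 0.
Proof.
move=> np_neq /rV0Pn[i gi_neq0] c0.
have x_neq0 : weight g 'e_i != 0 by rewrite weight_delta prime_embed_eq0.
have c_out m : m != i -> c 0 m = 0.
  move=> mi; have /rowP/(_ m)/eqP := c0 'e_i.
  rewrite !mxE (negPf mi) andbF mulr0 addr0 mulf_eq0 (negPf x_neq0).
  by move/eqP.
have wc : weight g c = weight g 'e_i * c 0 i.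
  rewrite weight_delta /weight (bigD1 i) //= big1 ?addr0 // => m mi.
  by rewrite c_out ?mulr0.
have wc0 : weight g c = 0 -> c 0 i = 0.
  by move/eqP; rewrite wc mulf_eq0 (negPf x_neq0) => /eqP.
suff ci0 : c 0 i = 0.
  by apply/rowP => m; rewrite mxE; have [->//|/c_out] := eqVneq m i.
apply: wc0; have [p2|p_neq2] := eqVneq p 2%N.
  have [k ki] : exists k : 'I_n, k != i.
    apply/existsP; apply: contra_notT np_neq => /existsPn all_i.
    split=> //; have := cardC1 i; rewrite card_ord.
    rewrite eq_card0 => [|k]; last by apply/negbTE/all_i.
    by have := ltn_ord i; lia.
  have /rowP/(_ k) := c0 'e_k.
  by rewrite !mxE !eqxx c_out // mulr0 add0r mulr1.
have /rowP/(_ i)/eqP := c0 'e_i; rewrite !mxE !eqxx mulr1 -wc -mulr2n.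
rewrite -mulr_natl mulf_eq0 -(dvdn_pcharf charFp) dvdn_prime2 //.
by rewrite (negPf p_neq2) => /eqP.
Qed.

Section Regular.
Variable a0 : 'rV[F]_n.
Hypothesis a0_inj : injective (fun g : G => weight g a0).
Local Notation comp := (@component F p charFp n).
Local Notation T0 := (vf 0 a0).

Let weight_eq0 g : (weight g a0 == 0) = (g == 0).
Proof. by rewrite -(weight0l charFp a0) (inj_eq a0_inj). Qed.

Lemma component0 g : comp 0 g = 0.
Proof. exact: (linear_0E (component_linear a0_inj g)). Qed.

Lemma component_lie_torus c w g :
  comp (lie (vf 0 c) w) g = weight g c *: comp w g.
Proof.
by rewrite (component_lie_vfield a0_inj) subr0 weight0l scale0r subr0.
Qed.

(** The powers of T0 detect the component in T.  As the radical is stable under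
brackets, they also detect, through [X^(-g) s, w], the component in X^g T. *)
Lemma der_mx_nondegenerate (f : 'I_(p ^ n) -> F) w :
    injective f -> ~ (n = 1%N /\ p = 2%N) ->
    (forall v k, \tr (der_mx v ^+ k * der_mx w) = 0) ->
  w = 0.
Proof.
move=> f_inj np_neq w_rad.
have cardG : #|{: G}| = (p ^ n)%N by rewrite card_mx mul1n card_Fp.
have torus0 v :
    (forall k, (k < #|{: G}|)%N -> \tr (der_mx T0 ^+ k * der_mx v) = 0) ->
  comp v 0 = 0.
  move=> v_rad; apply/rowP => i; rewrite [RHS]mxE -(weight_deltal charFp).
  have := power_sums_eq0 (V := F^o) (c := fun g => weight g (comp v 0)) a0_inj.
  by apply=> k /v_rad; rewrite (trace_der_mx_torus a0_inj).
apply: (component_ext a0_inj) => g; rewrite component0.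
have [->|g_neq0] := eqVneq g 0; first exact: torus0.
apply: (weight_sym_eq0 np_neq g_neq0) => s.
have : comp (lie (vf (- g) s) w) 0 = 0.
  have f'_inj : injective (f \o cast_ord cardG).
    by apply: inj_comp => // i j /(congr1 val)/val_inj.
  apply: torus0 => k ltk.
  exact: (trace_power_lie_eq0 (der_mx_linear a0_inj) (der_mx_lie a0_inj) f'_inj
            w_rad).
by rewrite (component_lie_vfield a0_inj) sub0r opprK weightNl scaleNr opprK.
Qed.

(** * Derivations of the Jacobson-Witt algebra are inner *)

Lemma component_sum_vfield (C : G -> 'rV[F]_n) g :
  comp (\sum_h vf h (C h)) g = C g.
Proof.
rewrite (linear_sumE (component_linear a0_inj _)) (bigD1 g) //=.
rewrite (component_vfield a0_inj) eqxx scale1r big1 ?addr0 // => h hg.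
by rewrite (component_vfield a0_inj) eq_sym (negPf hg) scale0r.
Qed.

Lemma lie_torus_vfield c g d : lie (vf 0 c) (vf g d) = weight g c *: vf g d.
Proof.
rewrite lie_vfield add0r weight0l scale0r subr0.
by rewrite (linear_scaleE (vfield_linear charFp _)).
Qed.

Lemma linear_vfield_ext (E E' : der A -> der A) : linear E -> linear E' ->
  (forall g i, E (vf g 'e_i) = E' (vf g 'e_i)) -> E =1 E'.
Proof.
move=> Elin E'lin EE' w; rewrite (der_decomposition a0_inj w).
rewrite (linear_sumE Elin) (linear_sumE E'lin); apply: eq_bigr => g _.
rewrite [component w g]row_sum_delta (linear_sumE (vfield_linear charFp g)).
rewrite (linear_sumE Elin) (linear_sumE E'lin); apply: eq_bigr => i _.
rewrite (linear_scaleE (vfield_linear charFp g)).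
by rewrite (linear_scaleE Elin) (linear_scaleE E'lin) EE'.
Qed.

Lemma centralizer_torus v : lie v T0 = 0 -> v = vf 0 (comp v 0).
Proof.
move=> vT0; apply: (component_ext a0_inj) => g.
rewrite (component_vfield a0_inj).
have [->|g_neq0] := eqVneq; first by rewrite scale1r.
rewrite scale0r; apply/eqP.
have /eqP : comp (lie T0 v) g = 0 by rewrite lieC vT0 oppr0 component0.
by rewrite component_lie_torus scaler_eq0 weight_eq0 (negPf g_neq0).
Qed.

(** The component of D(T0) in T commutes with all of W: apply D to
[T0, x] = r x, with x of weight r, and compare the components of that weight.
So it is zero, and the other components lie in the image of ad T0, which acts on
them by invertible scalars. *)
Lemma derivation_torus D : lie_derivation D -> exists u, D T0 = lie u T0.
Proof.
move=> [Dlin DM].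
have DT0_0 : comp (D T0) 0 = 0.
  apply/rowP => i; rewrite [RHS]mxE -(weight_deltal charFp); apply/eqP.
  (* On this x the component of D(T0) in T acts by its i-th entry. *)
  pose x := vf 'e_i 'e_i : der A.
  have /(congr1 (comp^~ 'e_i)) := DM T0 x.
  rewrite lie_torus_vfield (linear_scaleE Dlin).
  rewrite (linear_scaleE (component_linear a0_inj _)).
  rewrite (linear_addE (component_linear a0_inj _)) component_lie_torus.
  rewrite -[X in X = _]add0r => /addIr; rewrite lieC.
  rewrite (linear_oppE (component_linear a0_inj _)).
  rewrite (component_lie_vfield a0_inj).
  rewrite subrr weight0l scale0r sub0r opprK => /esym/rowP/(_ i)/eqP.
  by rewrite !mxE !eqxx mulr1.
pose v := \sum_g vf g ((weight g a0)^-1 *: comp (D T0) g).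
(* The summand of index 0 of v is zero, by the convention that 0^-1 = 0. *)
exists (- v); rewrite (linear_oppE (lie_linearl _)) -lieC.
apply: (component_ext a0_inj) => g; rewrite component_lie_torus.
rewrite component_sum_vfield scalerA.
have [->|g_neq0] := eqVneq g 0; first by rewrite DT0_0 scaler0.
by rewrite mulfV ?scale1r ?weight_eq0.
Qed.

Section KillsTorus.
Variable D : der A -> der A.
Hypotheses (Dder : lie_derivation D) (DT0 : D T0 = 0).
Let Dlin : linear D. Proof. by case: Dder. Qed.

(** D commutes with ad T0, hence preserves each eigenspace X^g T; the symbol is
the action of D on that space, read on T. *)
Definition symbol g c := comp (D (vf g c)) g.

Lemma derivation_vfield g c : D (vf g c) = vf g (symbol g c).
Proof.
apply: (component_ext a0_inj) => h; rewrite (component_vfield a0_inj).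
have [->|hg] := eqVneq; first by rewrite scale1r.
rewrite scale0r; apply/eqP.
have [_ /(_ T0 (vf g c))/(congr1 (comp^~ h))] := Dder.
rewrite DT0 (linear_0E (lie_linearl _)) add0r component_lie_torus.
rewrite lie_torus_vfield (linear_scaleE Dlin).
rewrite (linear_scaleE (component_linear a0_inj _)).
move=> /eqP; rewrite -subr_eq0 -scalerBl scaler_eq0 -weightBl weight_eq0.
by rewrite subr_eq0 eq_sym (negPf hg).
Qed.

Lemma symbol_lie g h c d :
  weight h c *: symbol (g + h) d - weight g d *: symbol (g + h) c
    = weight h (symbol g c) *: d - weight g d *: symbol g c
      + (weight h c *: symbol h d - weight g (symbol h d) *: c).
Proof.
have [_ /(_ (vf g c) (vf h d))/(congr1 (comp^~ (g + h)))] := Dder.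
rewrite lie_vfield !derivation_vfield !lie_vfield.
rewrite (linear_addE (component_linear a0_inj _)).
rewrite !(component_vfield a0_inj) eqxx !scale1r => <-.
rewrite /symbol (linear_subE (vfield_linear charFp _)).
rewrite !(linear_scaleE (vfield_linear charFp _)) (linear_subE Dlin).
rewrite !(linear_scaleE Dlin) (linear_subE (component_linear a0_inj _)).
by rewrite !(linear_scaleE (component_linear a0_inj _)).
Qed.

Lemma weight_delta_delta (i j : 'I_n) : weight 'e_i 'e_j = (i == j)%:R.
Proof. by rewrite weight_deltal mxE eqxx eq_sym. Qed.

(** Since vfield (- 'e_j) 'e_j is the partial derivative D_j, this says that D
multiplies D_j by a scalar; it follows from [D_i, D_j] = 0. *)
Lemma symbol_partial i j : i != j -> symbol (- 'e_j) 'e_j 0 i = 0.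
Proof.
move=> ij; have /rowP/(_ i) := symbol_lie (- 'e_i) (- 'e_j) 'e_i 'e_j.
rewrite !weightNl !weight_delta_delta eq_sym (negPf ij) !oppr0 !scale0r.
rewrite subrr subr0.
by rewrite !weight_deltal !mxE !eqxx (negPf ij) !mulr0 !add0r mulr1 opprK => <-.
Qed.

End KillsTorus.

(** The total degree of the exponents, taken in their representatives between 0
and p - 1; the bracket of X^g D_j with D_i is zero or lowers it by one. *)
Definition degree (g : G) : nat := (\sum_(i < n) (g ord0 i : nat))%N.

Lemma degree_pred g (i : 'I_n) :
  g 0 i != 0 -> degree g = (degree (g - 'e_i)).+1.
Proof.
move=> gi_neq0; rewrite /degree (bigD1 i) //= [in RHS](bigD1 i) //= -addSn.
congr (_ + _)%N; last first.
  by apply: eq_bigr => j /negPf ji; rewrite !mxE ji andbF subr0.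
by rewrite !mxE !eqxx /= Zp_pred.
Qed.

Lemma degree_gt1 g (i j : 'I_n) : i != j -> g 0 i != 0 -> g 0 j != 0 ->
  (1 < degree g)%N.
Proof.
move=> ij gi gj; rewrite (degree_pred gi) ltnS (@degree_pred _ j) //.
by rewrite !mxE [j == i]eq_sym (negPf ij) andbF subr0.
Qed.

Section KillsPartials.
Variable D : der A -> der A.
Hypotheses (Dder : lie_derivation D) (DT0 : D T0 = 0).
Hypothesis Dpartial : forall i, D (vf (- 'e_i) 'e_i) = 0.
Let Dlin : linear D. Proof. by case: Dder. Qed.
Local Notation phi := (symbol D).

(** The shift by e_j makes the vector field at stake X^g D_j, whose bracket with
D_i is a multiple of X^(g - e_i) D_j: this is what the induction on the degree
of g rests on. *)
Lemma derivation_kills_monomial g j : phi (g - 'e_j) 'e_j = 0.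
Proof.
have partial0 i : phi (- 'e_i) 'e_i = 0 by rewrite /symbol Dpartial component0.
have [m] := ubnP (degree g); elim: m g j => // m IHm g j ltgm.
(* D(X^h D_k) commutes with all D_l, by induction, so it is a combination of the
   D_i; being of weight h - e_k, it can involve D_i only when that is - e_i. *)
have const h k i : (degree h < m.+1)%N ->
    phi (h - 'e_k) 'e_k 0 i != 0 -> h - 'e_k = - 'e_i.
  move=> lthm phi_neq0.
  have lie0 l : weight (h - 'e_k) 'e_l *: phi (h - 'e_k) 'e_k
      + weight 'e_l (phi (h - 'e_k) 'e_k) *: 'e_l = 0.
    have := symbol_lie Dder DT0 (- 'e_l) (h - 'e_k) 'e_l 'e_k.
    rewrite partial0 weight0r scale0r scaler0 subr0 add0r.
    rewrite [weight (- 'e_l) (phi _ _)]weightNl scaleNr opprK => <-.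
    transitivity (prime_embed charFp (h 0 l) *: phi ((h - 'e_l) - 'e_k) 'e_k).
      rewrite [- 'e_l + _]addrCA addrA weightBl weightNl !weight_delta_delta.
      rewrite weight_delta.
      have [->|kl] := eqVneq k l; last by rewrite subr0 oppr0 scale0r subr0.
      by rewrite -scalerBl opprK subrK.
    have [->|hl] := eqVneq (h 0 l) 0; first by rewrite rmorph0 scale0r.
    rewrite IHm ?scaler0 //.
    by rewrite -ltnS -(degree_pred hl).
  apply/rowP => l.
  move: (phi _ _) phi_neq0 (lie0 l) => d d_neq0 /rowP/(_ i)/eqP.
  rewrite weight_deltal weight_delta !mxE /=; have [->|li] := eqVneq l i.
    rewrite mulr1 -[X in _ + X]mul1r -mulrDl mulf_eq0 (negPf d_neq0) orbF.
    rewrite -(rmorph1 (prime_embed charFp)) -rmorphD.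
    by rewrite prime_embed_eq0 addr_eq0 => /eqP ->.
  rewrite mulr0 addr0 mulf_eq0 (negPf d_neq0) orbF.
  by rewrite prime_embed_eq0 oppr0 => /eqP.
apply/rowP => i; rewrite [RHS]mxE; apply/eqP/negPn/negP => phi_neq0.
(* Apart from D_j itself, the remaining vector field is X_j X_i^(p-1) D_j, which
   has the weight of D_i.  It appears in
   [X_i D_j, X_j X_i^(p-1) D_i] = D_i - X_j X_i^(p-1) D_j, where D kills X_i D_j
   by induction and sends X_j X_i^(p-1) D_i, with the same exponents but another
   weight, to a combination of the D_l without D_i. *)
have gE : g = 'e_j - 'e_i by rewrite addrC -(const g j i) // subrK.
have [ij|ij] := eqVneq i j.
  by move: phi_neq0; rewrite gE ij subrr sub0r partial0 mxE eqxx.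
have gi : g 0 i = -1 by rewrite gE !mxE !eqxx (negPf ij) sub0r.
have gj : g 0 j = 1 by rewrite gE !mxE !eqxx eq_sym (negPf ij) subr0.
have phi1 : phi ('e_i - 'e_j) 'e_j = 0.
  (* X_i D_j has degree one, whereas the exponents i and j of g are nonzero. *)
  apply: IHm; rewrite -ltnS; apply: leq_trans ltgm; rewrite ltnS.
  rewrite (_ : degree 'e_i = 1%N).
    by apply: (degree_gt1 ij); rewrite ?gi ?gj ?oppr_eq0 oner_eq0.
  rewrite (@degree_pred _ i) ?mxE ?eqxx ?oner_eq0 // subrr /degree big1 //.
  by move=> k _; rewrite mxE.
have phi2 : phi (g - 'e_i) 'e_i 0 i = 0.
  apply/eqP/negPn/negP => /(const g i i ltgm)/eqP.
  rewrite -subr_eq0 opprK subrK => /eqP g0.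
  by move: gj; rewrite g0 mxE => /eqP; rewrite eq_sym oner_eq0.
have := symbol_lie Dder DT0 ('e_i - 'e_j) (g - 'e_i) 'e_j 'e_i.
have -> : 'e_i - 'e_j + (g - 'e_i) = - 'e_i.
  by rewrite gE !addrA subrK subrr sub0r.
have -> : phi (- 'e_i) 'e_j = phi (g - 'e_j) 'e_j.
  by rewrite gE addrAC subrr sub0r.
rewrite phi1 partial0 weight0r scale0r !scaler0 subr0 !sub0r.
rewrite (_ : weight ('e_i - 'e_j) 'e_i = 1); last first.
  by rewrite weightBl !weight_delta_delta eqxx eq_sym (negPf ij) subr0.
rewrite (_ : weight (g - 'e_i) 'e_j = 1); last first.
  rewrite weightBl weight_delta gj rmorph1 weight_delta_delta.
  by rewrite (negPf ij) subr0.
move: (phi (g - 'e_j) _) (phi (g - 'e_i) _) phi_neq0 phi2 => d d' d_neq0 d'i.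
move=> /rowP/(_ i)/eqP.
rewrite !mxE d'i (negPf ij) andbF !mulr0 subr0 addr0 mul1r oppr_eq0.
by rewrite (negPf d_neq0).
Qed.

Lemma derivation_kills_all w : D w = 0.
Proof.
pose Z w' : der A := 0 *: w'.
have Zlin : linear Z by move=> k x y; rewrite /Z !scale0r scaler0 addr0.
rewrite -[RHS](scale0r w); move: w; apply: (linear_vfield_ext Dlin Zlin) => g i.
rewrite derivation_vfield // /Z scale0r.
have := derivation_kills_monomial (g + 'e_i) i; rewrite addrK => ->.
exact: (linear_0E (vfield_linear charFp g)).
Qed.

End KillsPartials.

(** The corrections are made in two stages: ad u accounts for D(T0), then ad t,
with t in T, accounts for the scalars by which D multiplies the D_i and does not
change the value at T0. *)
Theorem derivation_inner D :
  lie_derivation D -> exists u, forall w, D w = lie u w.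
Proof.
move=> Dder; have [u DT0] := derivation_torus Dder.
pose D1 w := D w - lie u w.
have D1der : lie_derivation D1.
  by apply: lie_derivation_sub => //; apply: lie_derivation_inner.
have D1T0 : D1 T0 = 0 by rewrite /D1 DT0 subrr.
have [b bE] : exists b : 'I_n -> F,
    forall i, symbol D1 (- 'e_i) 'e_i = b i *: 'e_i.
  exists (fun i => symbol D1 (- 'e_i) 'e_i 0 i) => i; apply/rowP => k.
  have [->|ki] := eqVneq k i; rewrite [RHS]mxE [X in _ * X]mxE.
    by rewrite !eqxx mulr1.
  by rewrite (negPf ki) mulr0 (symbol_partial D1der D1T0).
pose t := vf 0 (\row_i - b i).
pose D2 w := D1 w - lie t w.
have D2der : lie_derivation D2.
  by apply: lie_derivation_sub => //; apply: lie_derivation_inner.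
have D2T0 : D2 T0 = 0.
  by rewrite /D2 D1T0 sub0r lie_torus_vfield weight0l scale0r oppr0.
have D2partial i : D2 (vf (- 'e_i) 'e_i) = 0.
  rewrite /D2 (derivation_vfield D1der D1T0) lie_torus_vfield weightNl.
  rewrite weight_deltal mxE opprK bE (linear_scaleE (vfield_linear charFp _)).
  exact: subrr.
exists (u + t) => w; rewrite (linear_addE (lie_linearl _)).
apply/eqP; rewrite addrC -subr_eq -subr_eq0; apply/eqP.
exact: (derivation_kills_all D2der D2T0 D2partial).
Qed.

(** * Two-local derivations of the Jacobson-Witt algebra *)

Lemma derivation_torus_inner D : lie_derivation D -> D T0 = 0 ->
  exists c, forall w, D w = lie (vf 0 c) w.
Proof.
move=> Dder DT0; have [u Du] := derivation_inner Dder.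
by exists (comp u 0) => w; rewrite -centralizer_torus // -Du.
Qed.

(** Pairing T0 with w shows that Delta acts at w as some element of T, which may
depend on w.  The sum y of all the basis vectors has nonzero entries on every
basis vector, so the element of T that represents Delta at y determines, by
linearity, the eigenvalue of Delta at each of them. *)
Lemma two_local_derivation_torus Delta :
    two_local_derivation Delta -> linear Delta -> Delta T0 = 0 ->
  exists c, forall w, Delta w = lie (vf 0 c) w.
Proof.
move=> Delta2 Dlin DT0.
have loc w : exists c, Delta w = lie (vf 0 c) w.
  have [D [Dder D0 ->]] := Delta2 T0 w.
  have [|c Dc] := derivation_torus_inner Dder; first by rewrite -D0.
  by exists c.
have /choice[mu muE] (gi : G * 'I_n) :
    exists m : F, Delta (vf gi.1 'e_gi.2) = m *: vf gi.1 'e_gi.2.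
  have [c ->] := loc (vf gi.1 'e_gi.2); exists (weight gi.1 c).
  exact: lie_torus_vfield.
pose y : der A := \sum_g vf g (const_mx 1).
have Dy : Delta y = \sum_g vf g (\row_i mu (g, i)).
  rewrite (linear_sumE Dlin); apply: eq_bigr => g _.
  rewrite [const_mx 1]row_sum_delta [\row_i mu (g, i)]row_sum_delta.
  rewrite !(linear_sumE (vfield_linear charFp g)) (linear_sumE Dlin).
  apply: eq_bigr => i _; rewrite !mxE scale1r.
  by rewrite (linear_scaleE (vfield_linear charFp g)) (muE (g, i)).
have [c yc] := loc y; exists c.
apply: (linear_vfield_ext Dlin (lie_linearr _)) => g i.
rewrite lie_torus_vfield (muE (g, i)); congr (_ *: _).
have := congr1 (comp^~ g) yc; rewrite component_lie_torus Dy.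
by rewrite !component_sum_vfield => /rowP/(_ i); rewrite !mxE mulr1.
Qed.

End Regular.

End WittAlgebra.

Theorem theorem3p19 (F : fieldType) (p : nat) (charFp : p \in [pchar F])
  (n : nat) (n_ge1 : (1 <= n)%N)
  (cardF : exists f : 'I_(p ^ n) -> F, injective f)
  (np_neq : ~ (n = 1%N /\ p = 2%N))
  (Delta : jacobson_witt charFp n -> jacobson_witt charFp n) :
  two_local_derivation Delta -> lie_derivation Delta.
Proof.
have [f f_inj] := cardF.
have [a0 a0_inj] := exists_injective_weight charFp f_inj.
move: Delta; rewrite /jacobson_witt => Delta Delta2.
have Dlin : linear Delta.
  apply: (two_local_derivation_linear (der_mx_linear a0_inj)
            (der_mx_lie a0_inj) (derivation_inner a0_inj) _ Delta2) => w.
  exact: (der_mx_nondegenerate a0_inj f_inj np_neq).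
have [D [Dder DT0 _]] := Delta2 (vfield charFp 0 a0) (vfield charFp 0 a0).
have [||c Dc] := two_local_derivation_torus a0_inj
  (two_local_derivation_sub Delta2 Dder).
- have [Dlin' _] := Dder => k x y.
  by rewrite Dlin Dlin' scalerBr opprD addrACA.
- by rewrite DT0 subrr.
have -> : Delta = (fun w => lie (vfield charFp 0 c) w + D w).
  by apply/funext => w; rewrite -Dc subrK.
by apply: lie_derivation_add => //; apply: lie_derivation_inner.
Qed.
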